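(* Let $R$ be a local ring and let $\mathcal C$ be the full subcategory of $\operatorname{Mod-}R$ whose objects are the modules $R/rR$ with $r\in J(R)\setminus\{0\}$. Let $\{U_i\mid i\in I\}$ and $\{V_j\mid j\in J\}$ be families of right $R$-modules in $\mathcal C$. Suppose there exist bijections $\sigma,\tau\colon I\to J$ such that $[U_i]_l=[V_{\sigma(i)}]_l$ and $[U_i]_e=[V_{\tau(i)}]_e$ for every $i\in I$. Then $\prod_{i\in I}U_i\cong\prod_{j\in J}V_j$.
   Context: $J(R)$ is the Jacobson radical and $U(R)$ the group of units. For $r,s\in J(R)\setminus\{0\}$, $R/rR$ and $R/sR$ have the same lower part, written $[R/rR]_l=[R/sR]_l$, if there exist $u,v\in U(R)$ and $x,y\in R$ with $ru=xs$ and $sv=yr$. $[M]_e=[N]_e$ (same epigeny class) means there exist epimorphisms $M\to N$ and $N\to M$. *)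

(* Defs.v *)
From HB Require Import structures.
From mathcomp Require Import all_boot all_order all_algebra.
Set Implicit Arguments. Unset Strict Implicit. Unset Printing Implicit Defensive.
Import GRing.Theory.
Local Open Scope ring_scope.

Section Defs.
Variable R : unitRingType.

(* Local ring: the non-units form an additive subgroup (equivalently, R has a
   unique maximal right ideal); R is nontrivial since unitRingType is an nzRing. *)
Definition local_ring : Prop :=
  forall x y : R, ~~ (x \is a GRing.unit) -> ~~ (y \is a GRing.unit) ->
    ~~ ((x + y) \is a GRing.unit).

Definition jacobson (x : R) : Prop := forall y : R, (1 - x * y) \is a GRing.unit.

Definition congr_r (r x y : R) : Prop := exists z : R, x - y = r * z.

(* The right R-module prod_{i in I} R/r_i R is represented as the setoid of
   functions I -> R modulo componentwise congruence; phi is a (representative of a)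
   right R-linear map prod_I R/r_iR -> prod_J R/s_jR. *)
Definition qhom (I J : Type) (r : I -> R) (s : J -> R)
  (phi : (I -> R) -> (J -> R)) : Prop :=
  [/\ (forall f g : I -> R, (forall i, congr_r (r i) (f i) (g i)) ->
          forall j, congr_r (s j) (phi f j) (phi g j)),
      (forall (f g : I -> R) j,
          congr_r (s j) (phi (fun i => f i + g i) j) (phi f j + phi g j)) &
      (forall (f : I -> R) (a : R) j,
          congr_r (s j) (phi (fun i => f i * a) j) (phi f j * a))].

Definition qsurj (I J : Type) (s : J -> R) (phi : (I -> R) -> (J -> R)) : Prop :=
  forall h : J -> R, exists f : I -> R, forall j, congr_r (s j) (phi f j) (h j).

Definition qinj (I J : Type) (r : I -> R) (s : J -> R)
  (phi : (I -> R) -> (J -> R)) : Prop :=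
  forall f g : I -> R, (forall j, congr_r (s j) (phi f j) (phi g j)) ->
    forall i, congr_r (r i) (f i) (g i).

Definition prod_iso (I J : Type) (r : I -> R) (s : J -> R) : Prop :=
  exists phi, [/\ qhom r s phi, qinj r s phi & qsurj s phi].

Definition cyc_epi (r s : R) : Prop :=
  exists phi, qhom (fun _ : unit => r) (fun _ : unit => s) phi /\
              qsurj (fun _ : unit => s) phi.

Definition same_epigeny (r s : R) : Prop := cyc_epi r s /\ cyc_epi s r.

Definition same_lower (r s : R) : Prop :=
  exists u v x y : R, [/\ u \is a GRing.unit, v \is a GRing.unit,
                          r * u = x * s & s * v = y * r].

Definition in_C (r : R) : Prop := jacobson r /\ r <> 0.
End Defs.

(* Main.v *)
(* After reindexing J along sigma, tau becomes a permutation of I, and every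
   permutation is a product of two involutions (it acts on each orbit as a
   rotation or a shift, which is a product of two reflections).  If i and j lie
   in one orbit, there is a module W in the category with the lower part of V_i
   and the epigeny class of V_j, by repeated exchange: from lower-part and
   epigeny classes (l, e), (l, e') and (l', e') one gets (l', e).  Inserting
   such modules reduces the theorem to the case where tau is an involution.
   The product then splits into blocks of size at most two, on which a 2x2
   matrix of homomorphisms is an isomorphism as soon as it and the matrix it
   induces on relations are invertible over R. *)
Require Import Defs.
From mathcomp Require Import all_boot all_order all_algebra.
From mathcomp Require Import zify.
From Stdlib Require Import Classical IndefiniteDescription.
From Stdlib Require Import FunctionalExtensionality PropExtensionality.
Import GRing.Theory.
Local Open Scope ring_scope.

(** * Orbits and permutations as products of two involutions *)

Section Orbits.
Set Implicit Arguments.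
Unset Strict Implicit.
Variables (I : Type) (tau : I -> I).

Definition same_orbit (i j : I) : Prop :=
  exists a b, iter a tau i = iter b tau j.

Lemma same_orbit_sym i j : same_orbit i j -> same_orbit j i.
Proof. by case=> a [b e]; exists b, a. Qed.

Lemma same_orbit_trans j i k :
  same_orbit i j -> same_orbit j k -> same_orbit i k.
Proof.
case=> a [b e] [c [d e']]; exists (c + a)%N, (b + d)%N.
by rewrite !iterD e -e' -!iterD addnC.
Qed.

Lemma same_orbit_step i : same_orbit i (tau i).
Proof. by exists 1%N, 0%N. Qed.

(** By extensionality, points of one orbit define equal predicates, so the choice depends only on
    the orbit. *)
Lemma orbit_representatives : exists rep : I -> I, forall i,
  same_orbit i (rep i) /\ forall j, same_orbit i j -> rep i = rep j.
Proof.
have ex i : exists j, same_orbit i j by exists i, 0%N, 0%N.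
pose cid := @constructive_indefinite_description I.
exists (fun i => proj1_sig (cid _ (ex i))) => i.
split=> [|j ij]; first exact: proj2_sig.
have E : same_orbit i = same_orbit j.
  apply: functional_extensionality => k; apply: propositional_extensionality.
  by split; apply: same_orbit_trans => //; apply: same_orbit_sym.
move: (ex i) (ex j); rewrite E => p q.
by rewrite (proof_irrelevance _ p q).
Qed.

Hypothesis tau_bij : bijective tau.

Lemma iter_bij n : bijective (iter n tau).
Proof.
case: tau_bij => g gK Kg; exists (iter n g) => x.
  by elim: n x => // n IH x; rewrite iterSr iterS gK IH.
by elim: n x => // n IH x; rewrite iterSr iterS Kg IH.
Qed.

(** With i = tau^n x, the reflection n -> -n - e is applied twice, giving j and then k. Exponents on
    a finite orbit are not unique; comparing the two expressions for j gives [loop], which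
    identifies k with i. The case e = 0 serves [rho], the case e = 1 serves [rho] after [tau]. *)
Lemma reflection_eq e a b c d x i j k :
  iter (a + e) tau i = iter b tau x -> iter b tau j = iter a tau x ->
  iter (c + e) tau j = iter d tau x -> iter d tau k = iter c tau x -> k = i.
Proof.
move=> h1 h2 h3 h4.
have loop : iter (c + e + a) tau x = iter (b + d) tau x.
  by rewrite iterD -h2 -iterD addnC iterD h3 -iterD.
apply: (bij_inj (iter_bij (d + (a + e)))).
rewrite [RHS]iterD h1 -iterD (addnC d b) -loop addnC iterD h4 -iterD.
by congr (iter _ _ _); lia.
Qed.

(* On the orbit of x, rho sends tau^n x to tau^(-n) x. *)
Lemma two_involutions : exists rho : I -> I,
  [/\ involutive rho, involutive (fun i => rho (tau i))
    & forall i, same_orbit i (rho i)].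
Proof.
have [rep repP] := orbit_representatives.
(* The integer exponent n of i is coded as b - a. *)
have /functional_choice [rho rhoP] : forall i, exists j, exists a b,
    iter a tau i = iter b tau (rep i) /\ iter b tau j = iter a tau (rep i).
  move=> i; have [[a [b e]] _] := repP i.
  have [g _ gK] := iter_bij b.
  by exists (g (iter a tau (rep i))), a, b.
have rho_orbit i : same_orbit i (rho i).
  have [a [b [e e']]] := rhoP i.
  apply: (@same_orbit_trans (rep i)); first by exists a, b.
  by exists a, b.
exists rho; split=> // i.
  have [a [b [e1 e2]]] := rhoP i.
  have [c [d []]] := rhoP (rho i).
  have [_ <-//] := repP i => e3 e4.
  by apply: (@reflection_eq 0 a b c d (rep i) _ (rho i)); rewrite ?addn0.
have [a [b [e1 e2]]] := rhoP (tau i).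
have [c [d []]] := rhoP (tau (rho (tau i))).
have [_ <-] := repP (tau i); last first.
  by apply: same_orbit_trans (rho_orbit _) (same_orbit_step _).
move=> e3 e4.
apply: (@reflection_eq 1 a b c d (rep (tau i)) _ (rho (tau i))) => //.
  by rewrite addn1 iterSr.
by rewrite addn1 iterSr.
Qed.

End Orbits.

(** * Units of a local ring *)

Section LocalRing.
Set Implicit Arguments.
Unset Strict Implicit.
Variables (R : unitRingType) (hloc : local_ring R).
Implicit Types r s t x y : R.
Local Notation unit x := (x \is a GRing.unit).

Lemma unit_subr x y : unit x -> ~~ unit y -> unit (x - y).
Proof.
move=> ux ny; apply: contraLR ux => nxy.
by rewrite -(subrK y x); apply: hloc nxy ny.
Qed.

Lemma unit_addr x y : unit x -> ~~ unit y -> unit (x + y).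
Proof. by move=> ux ny; rewrite -(opprK y) unit_subr ?unitrN. Qed.

(** The idempotent y * x is 1 if it is a unit. Otherwise 1 - y * x is a unit, so y * x = 0, against
    1 = x * (y * x) * y. *)
Lemma right_inverse_unit x y : x * y = 1 -> unit x.
Proof.
move=> xy1; have xyxy : y * x * (y * x) = y * x.
  by rewrite mulrA -(mulrA y) xy1 mulr1.
case: (boolP (unit (y * x))) => [u|nu].
  have yx1 : y * x = 1 by apply: (mulrI u); rewrite xyxy mulr1.
  by apply/unitrP; exists y.
have u : unit (1 - y * x) by rewrite unit_subr ?unitr1.
have yx0 : y * x = 0.
  by apply: (mulrI u); rewrite mulrBl mul1r xyxy subrr mulr0.
have := oner_neq0 R; rewrite -xy1 -(mulr1 (x * y)) -xy1 mulrA -(mulrA x y x).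
by rewrite yx0 mulr0 mul0r eqxx.
Qed.

Lemma unit_mul x y : unit (x * y) = unit x && unit y.
Proof.
case: (boolP (unit x)) => [ux|nx] /=; first by rewrite unitrMr.
apply: contraNF nx => u.
by apply: (@right_inverse_unit x (y * (x * y)^-1)); rewrite mulrA divrr.
Qed.

(** * The category, epigeny classes and lower parts *)

Lemma in_CP r : in_C r <-> ~~ unit r /\ r <> 0.
Proof.
split=> -[rJ rn0]; split=> //.
  by apply/negP => ur; have := rJ r^-1; rewrite divrr // subrr unitr0.
by move=> y; rewrite unit_subr ?unitr1 // unit_mul negb_and rJ.
Qed.

(* A map R/rR -> R/sR is left multiplication by some a with a * r = s * b; for s
   a non-unit of a local ring it is onto iff a is a unit.  Dually, b is a unit
   iff the map witnesses half of [same_lower]. *)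
Definition epi r s : Prop := exists a b, unit a /\ a * r = s * b.

Definition epieq r s : Prop := epi r s /\ epi s r.

Lemma congr_refl r x : congr_r r x x.
Proof. by exists 0; rewrite subrr mulr0. Qed.

Lemma congr_sym r x y : congr_r r x y -> congr_r r y x.
Proof. by move=> [z e]; exists (- z); rewrite mulrN -e opprB. Qed.

Lemma congr_trans r x y z : congr_r r x y -> congr_r r y z -> congr_r r x z.
Proof.
by move=> [k e] [l e']; exists (k + l); rewrite mulrDr -e -e' addrA subrK.
Qed.

(** Modulo s, [phi] is left multiplication by a = phi(1). Surjectivity makes some a * f congruent to
    1 modulo the non-unit s, so a is a unit; a * r lies in sR because r vanishes in R/rR. *)
Lemma cyc_epi_epi r s : ~~ unit s -> cyc_epi r s -> epi r s.
Proof.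
move=> ns [phi [[phi_congr _ phi_scale] phi_surj]].
pose a := phi (fun=> 1) tt.
have phiE f : congr_r s (phi f tt) (a * f tt).
  apply: congr_trans (phi_scale (fun=> 1) (f tt) tt).
  by apply: phi_congr => -[]; rewrite mul1r; apply: congr_refl.
have [f /(_ tt) f1] := phi_surj (fun=> 1).
have ua : unit a.
  have [z e] := congr_trans (congr_sym f1) (phiE f).
  have : unit (a * f tt).
    rewrite -(subKr 1 (a * f tt)) e.
    by rewrite unit_subr ?unitr1 // unit_mul negb_and ns.
  by rewrite unit_mul => /andP[].
have [||z e] := @congr_trans s (a * r) (phi (fun=> 0) tt) 0; last first.
- by exists a, z; rewrite -e subr0.
- by have := phiE (fun=> 0); rewrite mulr0.
apply: congr_trans (congr_sym (phiE (fun=> r))) _.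
by apply: phi_congr => _; exists 1; rewrite subr0 mulr1.
Qed.

Lemma same_epigeny_epieq r s :
  in_C r -> in_C s -> same_epigeny r s -> epieq r s.
Proof.
move=> /in_CP[nr _] /in_CP[ns _] [rs sr].
by split; apply: cyc_epi_epi.
Qed.

Lemma epi_refl r : epi r r.
Proof. by exists 1, 1; rewrite unitr1 mulr1 mul1r. Qed.

Lemma epi_trans s r t : epi r s -> epi s t -> epi r t.
Proof.
move=> [a [b [ua e]]] [c [d [uc e']]]; exists (c * a), (d * b).
by rewrite unit_mul uc ua -mulrA e mulrA e' mulrA.
Qed.

Lemma epieq_refl r : epieq r r.
Proof. by split; apply: epi_refl. Qed.

Lemma epieq_sym r s : epieq r s -> epieq s r.
Proof. by case. Qed.

Lemma epieq_trans s r t : epieq r s -> epieq s t -> epieq r t.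
Proof. by move=> [? ?] [? ?]; split; apply: (@epi_trans s). Qed.

Lemma same_lower_refl r : same_lower r r.
Proof. by exists 1, 1, 1, 1; rewrite unitr1 mulr1 mul1r. Qed.

Lemma same_lower_sym r s : same_lower r s -> same_lower s r.
Proof. by move=> [u [v [x [y [? ? ? ?]]]]]; exists v, u, y, x. Qed.

Lemma same_lower_trans s r t :
  same_lower r s -> same_lower s t -> same_lower r t.
Proof.
move=> [u [v [x [y [uu uv e1 e2]]]]] [u' [v' [x' [y' [uu' uv' e1' e2']]]]].
exists (u * u'), (v' * v), (x * x'), (y' * y).
split; rewrite ?unit_mul ?uu ?uv ?uu' ?uv' //.
  by rewrite mulrA e1 -mulrA e1' mulrA.
by rewrite mulrA e2' -mulrA e2 mulrA.
Qed.

Lemma iso_same_lower r s a b :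
  unit a -> unit b -> a * r = s * b -> same_lower r s.
Proof.
move=> ua ub e; exists b^-1, b, a^-1, a; split=> //; rewrite ?unitrV //.
by apply: (mulrI ua); rewrite mulrA e mulrA divrr // mul1r mulrK.
Qed.

Lemma iso_epieq r s a b :
  unit a -> unit b -> a * r = s * b -> epieq r s.
Proof.
move=> ua ub e; split; first by exists a, b.
exists a^-1, b^-1; rewrite unitrV; split=> //.
by apply: (mulrI ua); rewrite mulrA divrr // mul1r mulrA e mulrK.
Qed.

(** * Isomorphism from equal classes, and exchange of classes *)

(** One map has a unit on generators, the other a unit on relations. If neither has both, their sum
    does, since a unit plus a non-unit is a unit. *)
Lemma iso_of_classes r s : same_lower r s -> epi r s ->
  exists a b, [/\ unit a, unit b & a * r = s * b].
Proof.
move=> [_ [v [_ [y [_ uv _ e]]]]] [a [b [ua e']]].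
case: (boolP (unit b)) => [ub|nb]; first by exists a, b.
case: (boolP (unit y)) => [uy|ny]; first by exists y, v.
by exists (a + y), (v + b); rewrite !unit_addr // mulrDl e' -e mulrDr addrC.
Qed.

(* Here R/rR is a direct summand of R/sR (+) R/tR, embedded by (y, 1), and d
   presents its complement. *)
Lemma exchange_factored r s t u v x y c b e :
  ~~ unit t -> t <> 0 -> ~~ unit s -> s <> 0 ->
  unit u -> unit v -> unit c ->
  r * u = x * s -> s * v = y * r -> r = t * b -> c * t = r * e ->
  exists d, [/\ ~~ unit d, d <> 0, same_lower d t & epieq d s].
Proof.
move=> nt t0 ns s0 uu uv uc rux svy rtb cte.
(* Here rR = tR, so d = s has both classes. *)
case: (boolP (unit b)) => [ub|nb].
  exists s; split=> //; last exact: epieq_refl.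
  apply: (@same_lower_trans r); first by exists v, u, y, x.
  by apply: (@iso_same_lower _ _ 1 b); rewrite ?unitr1 ?mul1r.
(* Here R/rR and R/sR are isomorphic, so d = t has both classes. *)
case: (boolP (unit x)) => [ux|nx].
  exists t; split=> //; first exact: same_lower_refl.
  apply: (@epieq_trans r); first last.
    by apply: epieq_sym; apply: (@iso_epieq _ _ x u).
  by split; [exists c, e | exists 1, b; rewrite unitr1 mul1r].
(* The embedding (y, 1) followed by (x, c) is p, an automorphism of R/rR acting on relations as
   k. *)
pose p := x * y + c; pose k := u * v + e * b.
have up : unit p by rewrite /p addrC unit_addr // unit_mul negb_and nx.
have uk : unit k by rewrite /k unit_addr ?unit_mul ?uu // (negbTE nb) andbF.
have pr : p^-1 * r = r * k^-1.
  apply: (mulrI up); rewrite mulrA divrr // mul1r mulrA.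
  apply: (mulIr uk); rewrite mulrVK // /p /k mulrDl -mulrA -svy mulrA -rux.
  by rewrite mulrDr mulrA {4}rtb (mulrA c) cte mulrA.
pose w := 1 - b * k^-1 * e.
have td : t * w = p^-1 * x * (y * t).
  rewrite /w mulrBr mulr1 !mulrA -rtb -pr -(mulrA _ r) -cte -!mulrA.
  rewrite -[X in X - _](mulKr up) -mulrBr; congr (_ * _).
  by rewrite {1}/p mulrDl addrK mulrA.
have dbs : y * t * b = s * v by rewrite -mulrA -rtb -svy.
(* The cokernel of the embedding is R/(sR + ytR), and s lies in ytR by [dbs]. *)
exists (y * t); split.
- by rewrite unit_mul negb_and nt orbT.
- move=> d0; apply: s0; apply: (mulIr uv).
  by rewrite -dbs d0 !mul0r.
- exists 1, w, y, (p^-1 * x); split; rewrite ?unitr1 ?mulr1 //.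
  by rewrite unit_subr ?unitr1 // !unit_mul (negbTE nb).
split; last first.
  by exists 1, (b * v^-1); rewrite unitr1 mul1r mulrA dbs mulrK.
(* This is the R/sR entry of the projection that kills the embedded summand; it is a unit because x
   is not. *)
exists (1 - y * (p^-1 * x)), (v * k^-1 * e); split.
  by rewrite unit_subr ?unitr1 // !unit_mul (negbTE nx) !andbF.
rewrite mulrBl mul1r -(mulrA y) -td /w mulrBr mulr1 mulrBr opprB addrC subrK.
by rewrite !mulrA dbs.
Qed.

(** Replacing r by a * r, with a the unit of the epimorphism from R/rR to R/tR, keeps the module up
    to isomorphism and makes r factor through t. *)
Lemma exchange r s t : in_C s -> in_C t ->
  same_lower r s -> epieq r t ->
  exists d, [/\ in_C d, same_lower d t & epieq d s].
Proof.
move=> /in_CP[ns s0] /in_CP[nt t0].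
move=> [u [v [x [y [uu uv e1 e2]]]]] [[a [b [ua e3]]] [c [e [uc e4]]]].
have [|||||d [nd d0 dt ds]] :=
  @exchange_factored (a * r) s t u v (a * x) (y * a^-1) (a * c) b e
    nt t0 ns s0 uu uv.
- by rewrite unit_mul ua.
- by rewrite -!mulrA e1.
- by rewrite mulrA mulrVK.
- by [].
- by rewrite -!mulrA e4.
by exists d; split=> //; apply/in_CP.
Qed.

(** * Two-by-two systems and block isomorphisms *)

(** The unknown x of p x + m y = h, n x + q y = k; the inverted factor is the Schur complement of
    q. *)
Definition solve p m n q h k : R :=
  (p - m * q^-1 * n)^-1 * (h - m * q^-1 * k).

Lemma solve_uniq p m n q h k x y :
  unit p -> unit q -> ~~ unit m ->
  p * x + m * y = h -> n * x + q * y = k -> x = solve p m n q h k.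
Proof.
move=> up uq nm <- <-.
have ud : unit (p - m * q^-1 * n) by rewrite unit_subr // !unit_mul (negbTE nm).
apply: (mulrI ud); rewrite /solve mulVKr // mulrBl mulrDr !mulrA mulrVK //.
by rewrite opprD addrACA subrr addr0.
Qed.

Lemma solveP p m n q h k x y :
  unit p -> unit q -> ~~ unit m -> ~~ unit n ->
  p * x + m * y = h /\ n * x + q * y = k <->
  x = solve p m n q h k /\ y = solve q n m p k h.
Proof.
move=> up uq nm nn.
have uniq2 x' y' : p * x' + m * y' = h -> n * x' + q * y' = k ->
    x' = solve p m n q h k /\ y' = solve q n m p k h.
  move=> e1 e2; split; first exact: solve_uniq e1 e2.
  by apply: (@solve_uniq _ _ _ _ _ _ _ x') => //; rewrite addrC.
split=> [[]|[xE yE]]; first exact: uniq2.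
(* With z the second equation holds; the first follows from the formula for x, and uniqueness gives
   z = y. *)
pose z := q^-1 * (k - n * x).
have e2 : n * x + q * z = k by rewrite mulVKr // addrC subrK.
have ud : unit (p - m * q^-1 * n) by rewrite unit_subr // !unit_mul (negbTE nm).
have e1 : p * x + m * z = h.
  have : (p - m * q^-1 * n) * x = h - m * q^-1 * k by rewrite xE mulVKr.
  move/(congr1 (+%R^~ (m * q^-1 * k))); rewrite subrK => <-.
  by rewrite /z mulrBl !mulrBr !mulrA addrAC addrA.
by have [_] := uniq2 _ _ e1 e2; rewrite -yE => <-.
Qed.

(* A 2x2 matrix over a local ring is invertible if its units are exactly the
   entries of the diagonal, or exactly those of the antidiagonal. *)
Lemma solve_family (I : Type) (rho : I -> I) (al be : I -> R) :
  involutive rho -> (forall i, unit (al (rho i)) = unit (al i)) ->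
  (forall i, unit (be i) = ~~ unit (al i)) ->
  exists S : (I -> R) -> (I -> R), forall f h,
    (forall i, al i * f i + be i * f (rho i) = h i) <->
    (forall i, f i = S h i).
Proof.
move=> rhoK al_rho be_al; pose S h i := if unit (al i)
  then solve (al i) (be i) (be (rho i)) (al (rho i)) (h i) (h (rho i))
  (* The two equations are swapped to bring the units to the diagonal. *)
  else solve (be (rho i)) (al (rho i)) (al i) (be i) (h (rho i)) (h i).
have SP f h i :
    (al i * f i + be i * f (rho i) = h i /\
     al (rho i) * f (rho i) + be (rho i) * f i = h (rho i)) <->
    (f i = S h i /\ f (rho i) = S h (rho i)).
  rewrite /S rhoK al_rho; case: ifPn => ui.
    by rewrite [al (rho i) * _ + _]addrC; apply: solveP;
      rewrite ?be_al ?al_rho ?ui.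
  rewrite [al (rho i) * _ + _]addrC; split.
    by move=> [e1 e2]; apply/solveP; rewrite ?be_al ?al_rho ?ui.
  by move=> /solveP; rewrite ?be_al ?al_rho ?ui; case.
exists S => f h; split=> e i.
  by case: (SP f h i) => [[]] //; have := e (rho i); rewrite rhoK.
by case: (SP f h i) => _ [].
Qed.

(** The matrix (al, be) acts on generators and (b, d) on relations. Invertibility of the first gives
    surjectivity. For injectivity, the relation coefficients k are pulled back through the second,
    and uniqueness for the first identifies f - g with r times the result. *)
Lemma block_iso (I : Type) (rho : I -> I) (r s al be b d : I -> R) :
  involutive rho ->
  (forall i, unit (al (rho i)) = unit (al i)) ->
  (forall i, unit (be i) = ~~ unit (al i)) ->
  (forall i, unit (b (rho i)) = unit (b i)) ->
  (forall i, unit (d i) = ~~ unit (b i)) ->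
  (forall i, al i * r i = s i * b i) ->
  (forall i, be i * r (rho i) = s i * d i) ->
  prod_iso r s.
Proof.
move=> rhoK al_rho be_al b_rho d_b alr ber.
have [S SP] := solve_family rhoK al_rho be_al.
have [T TP] := solve_family rhoK b_rho d_b.
exists (fun f i => al i * f i + be i * f (rho i)); split; first split.
- move=> f g fg i; have [x ex] := fg i; have [y ey] := fg (rho i).
  exists (b i * x + d i * y).
  rewrite mulrDr !mulrA -alr -ber -!mulrA -ex -ey !mulrBr.
  by rewrite opprD addrACA.
- by move=> f g i; rewrite !mulrDr addrACA; apply: congr_refl.
- by move=> f a i; rewrite mulrDl !mulrA; apply: congr_refl.
- move=> f g /functional_choice[k ke] i; exists (T k i).
  have /SP e : forall i, al i * (f i - g i) + be i * (f (rho i) - g (rho i))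
      = s i * k i.
    by move=> j; rewrite -ke !mulrBr opprD addrACA.
  rewrite e; symmetry; move: i; apply/(SP (fun i => r i * T k i)) => i.
  rewrite !mulrA alr ber -!mulrA -mulrDr; congr (_ * _).
  by move: i; apply/TP.
- move=> h; exists (S h) => i.
  have /= -> := (SP (S h) h).2 (fun=> erefl) i.
  exact: congr_refl.
Qed.

(** If V_i and its partner share the epigeny class, U_i is isomorphic to V_i; if only the lower
    part, the partner of U_i is. Otherwise the units lie on the antidiagonal for generators and on
    the diagonal for relations. The patterns are expressed by [ss] and [sl], which are invariant
    under [rho]. *)
Lemma involution_iso (I : Type) (rho : I -> I) (r s : I -> R) :
  involutive rho ->
  (forall i, same_lower (r i) (s i)) ->
  (forall i, epieq (r i) (s (rho i))) -> prod_iso r s.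
Proof.
move=> rhoK rls res.
pose ss i := epieq (s i) (s (rho i)).
pose sl i := same_lower (s i) (s (rho i)).
have ss_rho i : ss (rho i) <-> ss i.
  by rewrite /ss rhoK; split; apply: epieq_sym.
have sl_rho i : sl (rho i) <-> sl i.
  by rewrite /sl rhoK; split; apply: same_lower_sym.
have entries i : exists z : R * R * (R * R), let: (al, be, (b, d)) := z in
  [/\ unit al <-> ss i, unit be = ~~ unit al, unit b <-> ss i \/ ~ sl i,
    unit d = ~~ unit b & al * r i = s i * b /\ be * r (rho i) = s i * d].
  have rs : epieq (r (rho i)) (s i) by have := res (rho i); rewrite rhoK.
  have [ssi|nss] := classic (ss i).
    have [|a [b [ua ub e]]] := iso_of_classes (rls i).
      by have [] := epieq_trans (res i) (epieq_sym ssi).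
    exists (a, 0, (b, 0)); rewrite ua ub unitr0; split=> //; try by split; auto.
    by rewrite mul0r mulr0.
  have [sli|nsl] := classic (sl i).
    have [||a [b [ua ub e]]] := @iso_of_classes (r (rho i)) (s i).
    - exact: same_lower_trans (rls _) (same_lower_sym sli).
    - by case: rs.
    exists (0, a, (0, b)); rewrite ua ub unitr0; split=> //.
    - by split=> // -[].
    - by rewrite mul0r mulr0.
  have [_ [v [_ [y [_ uv _ e]]]]] := rls i.
  have [[a [b [ua e']]] _] := rs.
  have ny : ~~ unit y.
    apply/negP => uy; case: nss; apply: epieq_trans (res i).
    by apply: epieq_sym; apply: (iso_epieq uy uv).
  have nb : ~~ unit b.
    apply/negP => ub; case: nsl.
    apply: same_lower_trans (rls (rho i)); apply: same_lower_sym.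
    exact: (iso_same_lower ua ub).
  exists (y, a, (v, b)); rewrite uv ua (negbTE ny) (negbTE nb); split=> //.
  by split; auto.
have [z zP] := functional_choice _ entries.
apply: (@block_iso _ rho _ _ (fun i => (z i).1.1) (fun i => (z i).1.2)
  (fun i => (z i).2.1) (fun i => (z i).2.2)) => // i.
all: move: (zP i) (zP (rho i)); case: (z i) => [[al be] [b d]] /=.
all: case: (z (rho i)) => [[al' be'] [b' d']] /= [a1 a2 a3 a4 [a5 a6]] //.
all: case=> c1 _ c3 _ _.
- by apply/idP/idP => [/c1/ss_rho/a1|/a1/ss_rho/c1].
- apply/idP/idP => [/c3 H|/a3 H]; [apply/a3|apply/c3];
    by move: H (sl_rho i) (ss_rho i); tauto.
Qed.

(** * Composition, reindexing and modules inserted along orbits *)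

Lemma prod_iso_trans (I J K : Type) (r : I -> R) (s : J -> R) (t : K -> R) :
  prod_iso r s -> prod_iso s t -> prod_iso r t.
Proof.
move=> [f [[f1 f2 f3] fi fs]] [g [[g1 g2 g3] gi gs]].
exists (fun h => g (f h)); split; first split.
- by move=> x y xy; apply: g1; apply: f1.
- by move=> x y k; apply: congr_trans (g2 _ _ _); apply: g1 => j; apply: f2.
- by move=> x a k; apply: congr_trans (g3 _ _ _); apply: g1 => j; apply: f3.
- by move=> x y xy; apply: fi; apply: gi.
move=> h; have [y yh] := gs h; have [x xy] := fs y.
by exists x => k; apply: congr_trans (yh k); apply: g1.
Qed.

Lemma prod_iso_reindex (I J : Type) (s : J -> R)
  (sigma : I -> J) : bijective sigma -> prod_iso (fun i => s (sigma i)) s.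
Proof.
move=> [g gK Kg]; exists (fun f j => f (g j)); split; first split.
- by move=> x y xy j; have := xy (g j); rewrite Kg.
- by move=> x y j; apply: congr_refl.
- by move=> x a j; apply: congr_refl.
- by move=> x y xy i; have := xy (sigma i); rewrite gK.
by move=> h; exists (fun i => h (sigma i)) => j; rewrite Kg; apply: congr_refl.
Qed.

(** [T i j] says that lower part i and epigeny class j occur together. The modules R/r_iR give
    [T i (tau i)], and the exchange law [Tex] chains these steps. *)
Lemma orbit_exchange (I : Type) (r s : I -> R) (tau : I -> I) :
  (forall i, in_C (r i)) -> (forall i, in_C (s i)) ->
  (forall i, same_lower (r i) (s i)) -> (forall i, epieq (r i) (s (tau i))) ->
  forall i j, same_orbit tau i j ->
  exists w, [/\ in_C w, same_lower w (s i) & epieq w (s j)].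
Proof.
move=> hr hs rls res.
pose T i j := exists w, [/\ in_C w, same_lower w (s i) & epieq w (s j)].
have Trefl i : T i i.
  exists (s i); split=> //; [exact: same_lower_refl | exact: epieq_refl].
have Tex i j k l : T i j -> T i k -> T l k -> T l j.
  move=> [a [aC al ae]] [b [bC bl be]] [c [cC cl ce]].
  have [||d [dC dl de]] := @exchange b a c aC cC.
  - exact: same_lower_trans bl (same_lower_sym al).
  - by apply: epieq_trans be (epieq_sym ce).
  exists d; split=> //; first exact: same_lower_trans dl cl.
  exact: epieq_trans de ae.
have Ttau i n : T i (iter n tau i).
  elim: n => //= n IH; apply: Tex (Trefl _) IH.
  by exists (r (iter n tau i)).
move=> i j [a [b e]].
(* The forward paths of i and j meet here; reflexivity and [Tex] make [T] symmetric, so the path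
   from j can be reversed. *)
apply: (@Tex (iter b tau j)); [| exact: Trefl |].
  by apply: (@Tex j); [exact: Trefl | exact: Ttau | exact: Trefl].
by rewrite -e.
Qed.

End LocalRing.

Theorem theorem3p5 (R : unitRingType) (hloc : local_ring R)
  (I J : Type) (r : I -> R) (s : J -> R)
  (hr : forall i, in_C (r i)) (hs : forall j, in_C (s j))
  (sigma tau : I -> J) (hsigma : bijective sigma) (htau : bijective tau)
  (hl : forall i, same_lower (r i) (s (sigma i)))
  (he : forall i, same_epigeny (r i) (s (tau i))) :
  prod_iso r s.
Proof.
apply: prod_iso_trans (prod_iso_reindex s hsigma).
have [g gK Kg] := hsigma.
pose s' i := s (sigma i); pose pi i := g (tau i).
have pi_bij : bijective pi.
  by apply: bij_comp htau; exists sigma.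
have he' i : epieq (r i) (s' (pi i)).
  by rewrite /s' /pi Kg; apply: same_epigeny_epieq.
have [rho [rhoK rpK rho_orbit]] := two_involutions pi_bij.
have [i|w wP] := functional_choice
  (fun i w => [/\ in_C w, same_lower w (s' i) & epieq w (s' (rho i))]).
  by apply: (orbit_exchange hloc hr _ hl he') => // j; apply: hs.
(* Since [pi] is [rho] after the involution [rho] after [pi], the family w lies between: r to w uses
   the latter involution, w to [s'] uses [rho]. *)
apply: (@prod_iso_trans _ _ I _ _ w).
  apply: (involution_iso hloc rpK) => i.
    have [_ wl _] := wP i.
    exact: (same_lower_trans hloc (hl i) (same_lower_sym wl)).
  have [_ _ we] := wP (rho (pi i)); rewrite rhoK in we.
  exact: (epieq_trans hloc (he' i) (epieq_sym we)).
by apply: (involution_iso hloc rhoK) => i; have [] := wP i.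
Qed.
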